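(* Let $C_{(>,\neq)}(x,y)$ be the bivariate generating function of the Catalan words avoiding the ordered pair of relations $(>,\neq)$, where $x$ marks the length and $y$ marks the number of descents. Then $$C_{(>,\neq)}(x,y)=\frac{\left(1-2x - \sqrt {1 - 4 x + 4 x^2 - 4 x^3 y}\right) \left(1-x \right)}{2x^3y}.$$
   Context: A Catalan word of length $n$ is a word $w=w_1w_2\cdots w_n$ over the non-negative integers with $w_1=0$ and $0\leq w_i\leq w_{i-1}+1$ for $i=2,\dots,n$; the empty word is the unique Catalan word of length $0$. For relations $X,Y\in\{<,>,\leq,\geq,=,\neq\}$, a word $w$ contains the pattern $(X,Y)$ if there is an index $i\geq 1$ (with $i+2\le n$) such that $w_i\,X\,w_{i+1}$ and $w_{i+1}\,Y\,w_{i+2}$; otherwise $w$ avoids $(X,Y)$. The number of descents $\mathrm{des}(w)$ is the number of indices $i$ with $w_i>w_{i+1}$. The bivariate generating function is $C_{(X,Y)}(x,y)=\sum_{w}x^{|w|}y^{\mathrm{des}(w)}$, the sum being over all Catalan words $w$ (of any length $|w|\geq 0$) avoiding $(X,Y)$. Identities are between formal power series in $x$ with coefficients polynomials in $y$ (after clearing denominators); the square root of a power series with constant term $1$ is the one with constant term $1$. *)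

(* Defs.v *)
From HB Require Import structures.
From mathcomp Require Import all_boot all_order all_algebra.
From mathcomp Require Import boolp classical_sets.

Set Implicit Arguments.
Unset Strict Implicit.
Unset Printing Implicit Defensive.

Import Order.TTheory GRing.Theory Num.Theory.
Local Open Scope ring_scope.

(* Formal power series over R: [f n] is the coefficient of x^n in [f]. *)
Record fps (R : Type) := Fps { fps_coef :> nat -> R }.

HB.instance Definition _ (R : Type) := gen_eqMixin (fps R).
HB.instance Definition _ (R : Type) := gen_choiceMixin (fps R).

Lemma fpsP (R : Type) (f g : fps R) : (forall n, f n = g n) -> f = g.
Proof. by case: f g => [f] [g] /= /funext ->. Qed.

Section FpsRing.
Variable R : comNzRingType.
Implicit Types f g h : fps R.

Definition fps_const (c : R) : fps R := Fps (fun n => if n == 0%N then c else 0).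
Definition fps_x : fps R := Fps (fun n => (n == 1%N)%:R).

Definition fps_add f g := Fps (fun n => f n + g n).
Definition fps_opp f := Fps (fun n => - f n).
Definition fps_mul f g := Fps (fun n => \sum_(i < n.+1) f i * g (n - i)%N).

Let addA : associative fps_add.
Proof. by move=> f g h; apply: fpsP => n /=; rewrite addrA. Qed.
Let addC : commutative fps_add.
Proof. by move=> f g; apply: fpsP => n /=; rewrite addrC. Qed.
Let add0 : left_id (fps_const 0) fps_add.
Proof. by move=> f; apply: fpsP => n /=; rewrite if_same add0r. Qed.
Let addN : left_inverse (fps_const 0) fps_opp fps_add.
Proof. by move=> f; apply: fpsP => n /=; rewrite if_same addNr. Qed.

HB.instance Definition _ := GRing.isZmodule.Build (fps R) addA addC add0 addN.

Let trunc N f : {poly R} := \poly_(i < N) f i.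

Let mul_trunc N f g n :
  (n < N)%N -> fps_mul f g n = (trunc N f * trunc N g)`_n.
Proof.
move=> nN; rewrite coefM; apply: eq_bigr => i _ /=.
have iN : (i < N)%N by apply: leq_trans nN; case: i.
by rewrite !coef_poly iN (leq_ltn_trans (leq_subr _ _) nN).
Qed.

Let mulC : commutative fps_mul.
Proof. by move=> f g; apply: fpsP => n; rewrite !(@mul_trunc n.+1) // mulrC. Qed.

Let mulA : associative fps_mul.
Proof.
move=> f g h; apply: fpsP => n.
have trM u v (i : nat) : (i < n.+1)%N ->
    (trunc n.+1 (fps_mul u v))`_i = (trunc n.+1 u * trunc n.+1 v)`_i.
  by move=> ilt; rewrite coef_poly ilt (@mul_trunc n.+1).
rewrite !(@mul_trunc n.+1) //.
transitivity ((trunc n.+1 f * (trunc n.+1 g * trunc n.+1 h))`_n).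
  rewrite !coefM; apply: eq_bigr => i _.
  by rewrite trM ?ltnS ?leq_subr.
rewrite mulrA [LHS]coefM [RHS]coefM; apply: eq_bigr => i _.
by rewrite trM.
Qed.

Let mul1 : left_id (fps_const 1) fps_mul.
Proof.
move=> f; apply: fpsP => n /=.
by rewrite big_ord_recl /= subn0 mul1r big1 ?addr0 // => i _; rewrite mul0r.
Qed.

Let mulDl : left_distributive fps_mul fps_add.
Proof.
move=> f g h; apply: fpsP => n /=.
by rewrite -big_split /=; apply: eq_bigr => i _; rewrite mulrDl.
Qed.

Let one_neq0 : fps_const 1 != 0 :> fps R.
Proof.
apply/eqP => /(congr1 (fun f : fps R => f 0%N)) /= /eqP.
by rewrite oner_eq0.
Qed.

HB.instance Definition _ := GRing.Zmodule_isComNzRing.Build (fps R)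
  mulA mulC mul1 mulDl one_neq0.

Lemma fps_coefM f g n : (f * g) n = \sum_(i < n.+1) f i * g (n - i)%N.
Proof. by []. Qed.

End FpsRing.
Arguments fps_x {R}.

Local Open Scope classical_set_scope.

(* The square root of [f] having constant term 1. *)
Definition fps_sqrt (R : comNzRingType) (f : fps R) : fps R :=
  xget 0 [set s : fps R | s 0%N = 1 /\ s ^+ 2 = f].

Local Close Scope classical_set_scope.

(* If 2 is invertible and [f] has constant term 1, such a root exists and is
   unique, so that the default value 0 above is not used. *)
Section FpsSqrt.
Variable R : comUnitRingType.
Hypothesis unit2 : (2 : R) \is a GRing.unit.
Variable f : fps R.
Hypothesis f0 : f 0%N = 1.

Let coef_sqr (s : fps R) n : s 0%N = 1 ->
  (s ^+ 2) n.+1 = 2 * s n.+1 + \sum_(i < n) s i.+1 * s (n - i)%N.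
Proof.
move=> s0; rewrite expr2 fps_coefM big_ord_recl big_ord_recr /= subn0 s0.
rewrite /bump /= add1n subnn s0 mul1r mulr1 mulr_natl mulr2n -addrA.
congr (_ + _); rewrite addrC; congr (_ + _); by apply: eq_bigr => i _; rewrite subSS.
Qed.

Let prefix := fix prefix n : seq R := if n is m.+1 then
    let s := prefix m in
    rcons s ((f m.+1 - \sum_(i < m) s`_i.+1 * s`_(m - i)) / 2)
  else [:: 1].

Let root : fps R := Fps (fun n => (prefix n)`_n).

Let size_prefix n : size (prefix n) = n.+1.
Proof. by elim: n => //= n IHn; rewrite size_rcons IHn. Qed.

Let prefixE m n : (n <= m)%N -> (prefix m)`_n = root n.
Proof.
elim: m => [|m IHm]; first by case: n.
rewrite leq_eqVlt => /orP[/eqP -> //|nm].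
by rewrite /= nth_rcons size_prefix nm IHm.
Qed.

Lemma fps_sqrt_exists : exists s : fps R, s 0%N = 1 /\ s ^+ 2 = f.
Proof.
exists root; split=> //; apply: fpsP => -[|n].
  by rewrite expr2 fps_coefM big_ord1 /= mulr1 f0.
rewrite coef_sqr // {1}/root /= nth_rcons size_prefix ltnn eqxx.
rewrite mulrC divrK // [X in _ - X](_ : _ = \sum_(i < n) root i.+1 * root (n - i)%N) ?subrK //.
by apply: eq_bigr => i _; rewrite !prefixE ?leq_subr.
Qed.

Lemma fps_sqrt_uniq (s t : fps R) :
  s 0%N = 1 -> t 0%N = 1 -> s ^+ 2 = t ^+ 2 -> s = t.
Proof.
move=> s0 t0 st; apply: fpsP => n; have [m] := ubnP n.
elim: m n => // m IHm [_|n nm]; first by rewrite s0 t0.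
have : (s ^+ 2) n.+1 = (t ^+ 2) n.+1 by rewrite st.
rewrite !coef_sqr //.
rewrite (_ : \sum_(i < n) s i.+1 * s (n - i)%N =
             \sum_(i < n) t i.+1 * t (n - i)%N).
  by move=> /addIr /(mulrI unit2).
apply: eq_bigr => i _.
by rewrite !IHm // -?(ltnS _ m) ?(leq_trans _ nm) ?ltnS ?leq_subr.
Qed.

Lemma fps_sqrtP : fps_sqrt f 0%N = 1 /\ fps_sqrt f ^+ 2 = f.
Proof. exact: (xgetPex 0 fps_sqrt_exists). Qed.

End FpsSqrt.

Local Open Scope nat_scope.

(* Words are indexed from 0; [head 0] lets the empty word through. *)
Definition catalan (w : seq nat) : bool :=
  (head 0 w == 0) && sorted (fun a b => b <= a.+1) w.

Definition contains (X Y : rel nat) (w : seq nat) : bool :=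
  [exists i : 'I_(size w),
    [&& i.+2 < size w, X (nth 0 w i) (nth 0 w i.+1)
      & Y (nth 0 w i.+1) (nth 0 w i.+2)]].

Definition avoids (X Y : rel nat) (w : seq nat) : bool := ~~ contains X Y w.

Definition des (w : seq nat) : nat :=
  #|[set i : 'I_(size w) | (i.+1 < size w) && (nth 0 w i > nth 0 w i.+1)]|.

(* By this bound, every Catalan word of length n is an n-tuple of letters less
   than n; the sum in [catalan_gf] ranges over such tuples. *)
Lemma catalan_ltn_size (w : seq nat) : catalan w -> all (ltn^~ (size w)) w.
Proof.
case: w => [//|a w] /andP[/= /eqP -> pw].
have bnd b s : path (fun a b => b <= a.+1) b s ->
    all (fun c => c <= b + size s) s.
  elim: s b => [//|c s IHs] b /= /andP[cb /IHs Hs].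
  apply/andP; split; first by rewrite addnS -addSn (leq_trans cb) ?leq_addr.
  apply: sub_all Hs => d /leq_trans; apply.
  by rewrite addnS -addSn leq_add2r.
by apply: sub_all (bnd _ _ pw) => c; rewrite /= add0n ltnS.
Qed.

Local Close Scope nat_scope.

(* The bivariate generating function: a power series in x over the polynomials
   in y, here the indeterminate of {poly rat}. *)
Definition catalan_gf (X Y : rel nat) : fps {poly rat} :=
  Fps (fun n =>
    \sum_(w : n.-tuple 'I_n | catalan (map val w) && avoids X Y (map val w))
      'X^(des (map val w))).

(* Main.v *)
(* A nonempty Catalan word factors uniquely at its first return to 0, as
   0 (u+1) v with u and v Catalan.  If u and v are nonempty, a descent leads
   into v, so the word avoids (>, <>) iff u and v do, u does not end in a
   descent, and v is 0 or starts with 00.  Removing the first letter of such a v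
   leaves an arbitrary avoiding word.  With E counting the nonempty avoiding
   words that do not end in a descent, this gives
     C = 1 - x + 2 x C + x^2 y E C   and   E = x + 2 x E + x^2 y E^2.
   The second equation says that 1 - 2 x - 2 x^2 y E is the square root in the
   formula.  For U = 1 - 2 x - x^2 y E, one has C U = 1 - x and E U = x, so
   x C = (1 - x) E. *)
Require Import Defs.
From mathcomp Require Import all_boot all_order all_algebra.
From mathcomp Require Import ring.

Set Implicit Arguments.
Unset Strict Implicit.
Unset Printing Implicit Defensive.

Import GRing.Theory.

Local Open Scope nat_scope.

(** * Recursive rules for avoidance, descents and final descents *)

Lemma contains_cons (X Y : rel nat) a s :
  contains X Y (a :: s) =
    [&& 1 < size s, X a (nth 0 s 0) & Y (nth 0 s 0) (nth 0 s 1)]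
    || contains X Y s.
Proof.
apply/existsP/orP => [[[[|i] ilt] /= Hi]|[H|/existsP[[i ilt] Hi]]].
- by left.
- by right; apply/existsP; exists (Ordinal (ilt : i < size s)).
- by exists ord0.
- by exists (lift ord0 (Ordinal ilt)).
Qed.

(** The default [a] in [nth a s 0] makes an empty tail contribute no descent. *)
Lemma des_cons a s : des (a :: s) = (nth a s 0 < a) + des s.
Proof.
rewrite /des !cardsE -!sum1_card !big_mkcond big_ord_recl /=; congr (_ + _).
  by rewrite unfold_in /=; case: s => [|b s] /=; rewrite ?ltnn //; case: ltnP.
by rewrite [RHS]big_mkcond; apply: eq_bigr => i _.
Qed.

Definition avoids_gt_neq := avoids (fun a b => a > b) (fun a b => a != b).

Lemma avoids_gt_neq_cons a s :
  avoids_gt_neq (a :: s) =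
    (if s is b :: c :: _ then (a <= b) || (b == c) else true)
    && avoids_gt_neq s.
Proof.
rewrite /avoids_gt_neq /avoids contains_cons negb_or; congr (_ && _).
by case: s => [|b [|c s]] //=; rewrite negb_and -leqNgt negbK.
Qed.

Fixpoint ends_in_descent (s : seq nat) : bool :=
  if s is a :: t then if t is [:: b] then b < a else ends_in_descent t
  else false.

Lemma avoids_gt_neq_nil : avoids_gt_neq [::].
Proof. by apply/existsP => -[[]]. Qed.

Lemma des_nil : des [::] = 0.
Proof. by rewrite /des eq_card0 // => -[]. Qed.

Lemma avoids_gt_neq_mapS u : avoids_gt_neq (map S u) = avoids_gt_neq u.
Proof.
elim: u => //= a u IHu; rewrite !avoids_gt_neq_cons IHu.
by case: u {IHu} => [|b [|c u]].
Qed.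

Lemma des_mapS u : des (map S u) = des u.
Proof.
elim: u => // a u IHu.
by rewrite (des_cons a) -IHu /= des_cons; case: u {IHu} => //=; rewrite !ltnn.
Qed.

Lemma ends_in_descent_mapS u : ends_in_descent (map S u) = ends_in_descent u.
Proof. by elim: u => //= a [|b [|c u]] IHu. Qed.

(** Only two windows straddle the junction. The last letter of [map S u] is positive, hence a
    descent into 0: the window ending at this 0 forbids a final descent in [u], and the window
    centred at it forces [v] to be empty or to start with 0. *)
Lemma avoids_gt_neq_mapS_cat0 u v : u != [::] ->
  avoids_gt_neq (map S u ++ 0 :: v) =
    [&& avoids_gt_neq u, ~~ ends_in_descent u, head 0 v == 0
      & avoids_gt_neq (0 :: v)].
Proof.
elim: u => // a u IHu _; rewrite /= avoids_gt_neq_cons.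
case: u IHu => [_|b u ->] //=.
  rewrite (avoids_gt_neq_cons a) avoids_gt_neq_nil /=.
  by case: v => //= b v; rewrite eq_sym.
rewrite (avoids_gt_neq_cons a) /=.
case: u => [|c u] //=; last by rewrite eqSS ltnS -!andbA.
by rewrite orbF ltnS -leqNgt /= avoids_gt_neq_cons avoids_gt_neq_nil.
Qed.

Lemma des_mapS_cat0 u v : u != [::] ->
  des (map S u ++ 0 :: v) = (des u + des (0 :: v)).+1.
Proof.
elim: u => // a [|b u] IHu _ /=.
  by rewrite !(des_cons a.+1) !(des_cons a) /= ltnn des_nil.
rewrite des_cons /=; have /= -> := IHu isT.
by rewrite (des_cons a) !ltnS addnS addnA.
Qed.

Lemma ends_in_descent_mapS_cat0 u v : u != [::] ->
  ends_in_descent (map S u ++ 0 :: v) = (v == [::]) || ends_in_descent (0 :: v).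
Proof.
elim: u => // a [|b u] IHu _ /=; first by case: v {IHu}.
by have /= -> := IHu isT; case: u {IHu}.
Qed.

Lemma avoids_gt_neq_cons0 s : avoids_gt_neq (0 :: s) = avoids_gt_neq s.
Proof. by rewrite avoids_gt_neq_cons; case: s => [|b [|c s]]. Qed.

Lemma des_cons0 s : des (0 :: s) = des s.
Proof. by rewrite des_cons ltn0. Qed.

Lemma ends_in_descent_cons0 s : ends_in_descent (0 :: s) = ends_in_descent s.
Proof. by case: s => [|b []]. Qed.

(** * The first-return factorization of Catalan words *)

Lemma head_catalan u : catalan u -> head 0 u = 0.
Proof. by case/andP=> /eqP. Qed.

(** The step from 0 into [map S u] forces [u] to start with 0, and the step into a 0 heading [v] is
    always allowed. *)
Lemma catalan_first_return u v : head 0 v = 0 ->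
  catalan (0 :: map S u ++ v) = catalan u && catalan v.
Proof.
move=> v0; rewrite /catalan /= v0 /= cat_path; congr (_ && _).
  by case: u => //= a u; rewrite path_map ltnS leqn0.
by case: v v0 => //= a v ->.
Qed.

Definition catalan_words n : seq (seq nat) :=
  [seq s <- [seq map val w | w : n.-tuple 'I_n] | catalan s].

Lemma mem_catalan_words n s :
  (s \in catalan_words n) = catalan s && (size s == n).
Proof.
rewrite mem_filter; have [cs|//] /= := boolP (catalan s).
apply/imageP/eqP => [[w _ ->]|sn]; first by rewrite size_map size_tuple.
have/allP bnd : all (ltn^~ n) s by rewrite -sn catalan_ltn_size.
(* All letters are below [n], so [insub] drops none of them. *)
have sz : size (pmap insub s : seq 'I_n) == n.
  by rewrite size_pmap_sub -[X in _ == X]sn -all_count; apply/allP.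
exists (Tuple sz) => //=; rewrite pmap_filter ?(all_filterP _) //.
- by apply/allP => i /bnd iin; rewrite insubT.
- exact: insubK.
Qed.

Lemma uniq_catalan_words n : uniq (catalan_words n).
Proof.
rewrite filter_uniq // map_inj_uniq ?enum_uniq // => v w.
by move/(inj_map val_inj)/val_inj.
Qed.

Lemma index0_mapS_cat u v : head 0 v = 0 -> index 0 (map S u ++ v) = size u.
Proof. by case: v => [_|b v /= ->]; elim: u => //= a u ->. Qed.

(** The cut is at the first 0 of the tail; if there is none, [index] returns the length [n] of the
    tail and [v] is empty. *)
Lemma first_return_words n k : k <= n ->
  perm_eq [seq s <- catalan_words n.+1 | index 0 (behead s) == k]
    [seq 0 :: map S u ++ v | u <- catalan_words k, v <- catalan_words (n - k)].
Proof.
move=> kn; apply: uniq_perm => [||s].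
- by rewrite filter_uniq ?uniq_catalan_words.
- apply: allpairs_uniq; rewrite ?uniq_catalan_words // => -[u v] [u' v'].
  move=> /allpairsP[[u1 v1] /= [Hu _ [-> ->]]].
  move=> /allpairsP[[u2 v2] /= [Hu' _ [-> ->]]].
  move: Hu Hu'; rewrite !mem_catalan_words => /andP[_ /eqP su] /andP[_ /eqP su'].
  move=> [] /eqP; rewrite eqseq_cat ?size_map ?su ?su' //.
  by case/andP=> /eqP/(inj_map succn_inj) -> /eqP ->.
- rewrite mem_filter mem_catalan_words; apply/and3P/allpairsP => [|[[u v]]] /=.
    case: s => [[_ _ //]|a t [/eqP tk ct /eqP[tn]]].
    have a0 : a = 0 by case/andP: ct => /eqP.
    have tE : t = map S (map predn (take k t)) ++ drop k t.
      (* Letters before the first 0 are positive, so [S] undoes [predn] on them. *)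
      rewrite -map_comp map_id_in ?cat_take_drop // => b bt /=.
      rewrite prednK // lt0n; apply: contraL bt => /eqP ->.
      by rewrite in_take_leq ?tn // tk ltnn.
    have v0 : head 0 (drop k t) = 0.
      rewrite -nth0 nth_drop addn0.
      have [tk'|kt] := leqP (size t) k; first by rewrite nth_default.
      by rewrite -tk nth_index // -index_mem tk.
    exists (map predn (take k t), drop k t); split=> /=.
    + rewrite mem_catalan_words; move: ct; rewrite a0 {1}tE catalan_first_return //.
      by case/andP=> -> _; rewrite size_map size_takel ?tn ?eqxx.
    + rewrite mem_catalan_words; move: ct; rewrite a0 {1}tE catalan_first_return //.
      by case/andP=> _ ->; rewrite size_drop tn eqxx.
    + by rewrite a0 -tE.
  case; rewrite !mem_catalan_words => /andP[cu /eqP uk] /andP[cv /eqP nv] ->.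
  have v0 := head_catalan cv.
  rewrite catalan_first_return ?cu ?cv //= index0_mapS_cat // uk eqxx.
  by split=> //; rewrite size_cat size_map uk nv subnKC.
Qed.

Local Open Scope ring_scope.

(** * From the factorization of words to equations between power series *)

Section FirstReturn.
Variable R : comNzRingType.
Implicit Types (f g : fps R) (F : seq nat -> R).

Lemma fps_coefD f g n : (f + g) n = f n + g n.
Proof. by []. Qed.

Lemma fps_coef_sum (I : Type) (r : seq I) (f : I -> fps R) n :
  (\sum_(i <- r) f i) n = \sum_(i <- r) f i n.
Proof. by elim/big_rec2: _ => [|i a b _ <-] //; exact: if_same. Qed.

Lemma fps_constM c f n : (fps_const c * f) n = c * f n.
Proof.
rewrite fps_coefM big_ord_recl /= subn0 big1 ?addr0 // => i _.
by rewrite mul0r.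
Qed.

Lemma fps_xM0 f : (fps_x * f) 0%N = 0.
Proof. by rewrite fps_coefM big_ord1 mul0r. Qed.

Lemma fps_xMS f n : (fps_x * f) n.+1 = f n.
Proof.
rewrite fps_coefM big_ord_recl /= mul0r add0r big_ord_recl /= mul1r subSS subn0.
by rewrite big1 ?addr0 // => i _; rewrite mul0r.
Qed.

Definition word_gf F : fps R := Fps (fun n => \sum_(s <- catalan_words n) F s).

Lemma catalan_words0 : catalan_words 0 = [:: [::]].
Proof.
apply: perm_small_eq => //; apply: uniq_perm; rewrite ?uniq_catalan_words //.
by case=> [|a s]; rewrite mem_catalan_words // andbF.
Qed.

Lemma word_gf_nil : word_gf (fun s => (s == [::])%:R) = 1.
Proof.
apply: fpsP => -[|n] /=; first by rewrite catalan_words0 big_seq1.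
rewrite big_seq big1 // => s; rewrite mem_catalan_words.
by case: s => //; rewrite andbF.
Qed.

Lemma word_gfZ c F : word_gf (fun s => c * F s) = fps_const c * word_gf F.
Proof. by apply: fpsP => n; rewrite fps_constM /= mulr_sumr. Qed.

Lemma sum_first_return F n :
  \sum_(s <- catalan_words n.+1) F s =
  \sum_(k < n.+1) \sum_(u <- catalan_words k) \sum_(v <- catalan_words (n - k))
    F (0%N :: map S u ++ v).
Proof.
(* The tail has length [n], so its index is at most [n] and [inord] preserves it. *)
pose ix (s : seq nat) : 'I_n.+1 := inord (index 0%N (behead s)).
have ixE s : s \in catalan_words n.+1 -> ix s = index 0%N (behead s) :> nat.
  rewrite mem_catalan_words => /andP[_ /eqP sn].
  by rewrite inordK // ltnS (leq_trans (index_size _ _)) // size_behead sn.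
rewrite (partition_big ix xpredT) //=; apply: eq_bigr => k _.
have kn : (k <= n)%N by rewrite -ltnS.
rewrite -(big_allpairs_dep (h := fun u v => 0%N :: map S u ++ v)).
rewrite -(perm_big _ (first_return_words kn)) big_filter.
rewrite [LHS]big_seq_cond [RHS]big_seq_cond; apply: eq_bigl => s.
by apply: andb_id2l => /ixE sE; rewrite -val_eqE /= sE.
Qed.

(** Summing a product over pairs of words of lengths [k] and [n - k] gives a Cauchy product, and the
    leading 0 gives the factor [fps_x]. Each functional equation thus reduces to splitting a weight
    into finitely many products. *)
Lemma word_gf_first_return F (Fs : seq ((seq nat -> R) * (seq nat -> R))) :
  (forall u v, catalan u -> catalan v ->
     F (0%N :: map S u ++ v) = \sum_(p <- Fs) p.1 u * p.2 v) ->
  word_gf F =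
    fps_const (F [::]) + fps_x * \sum_(p <- Fs) word_gf p.1 * word_gf p.2.
Proof.
move=> FE; apply: fpsP => -[|n]; rewrite fps_coefD.
  by rewrite fps_xM0 addr0 /= catalan_words0 big_seq1.
rewrite fps_xMS /= add0r fps_coef_sum sum_first_return.
under [RHS]eq_bigr => p _ do rewrite fps_coefM.
rewrite [RHS]exchange_big; apply: eq_bigr => k _ /=.
under [RHS]eq_bigr => p _ do rewrite mulr_suml.
rewrite [RHS]exchange_big; apply: eq_big_seq => u /=.
rewrite mem_catalan_words => /andP[cu _].
under [RHS]eq_bigr => p _ do rewrite mulr_sumr.
rewrite [RHS]exchange_big; apply: eq_big_seq => v /=.
by rewrite mem_catalan_words => /andP[cv _]; apply: FE.
Qed.

End FirstReturn.

(** * The functional equations for the weighted series *)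

Section Equations.
Variables (R : comNzRingType) (y : R).

Definition weight (s : seq nat) : R :=
  if avoids_gt_neq s then y ^+ des s else 0.

(** Its series is [E]. *)
Definition open_weight (s : seq nat) : R :=
  if (s != [::]) && ~~ ends_in_descent s then weight s else 0.

(** On Catalan words, this keeps those that may follow a nonempty [u] as a nonempty [v]: the word 0
    and the words starting with 00. *)
Definition flat_weight (s : seq nat) : R :=
  if (s != [::]) && (head 0%N (behead s) == 0%N) then weight s else 0.

(** The word 0 is excluded here: placed after a nonempty [u], it would create a final descent. *)
Definition flat_open_weight (s : seq nat) : R :=
  if (behead s != [::]) && (head 0%N (behead s) == 0%N) then open_weight s
  else 0.

Let one_nil (s : seq nat) : R := (s == [::])%:R.

Lemma weight_cons0 s : weight (0%N :: s) = weight s.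
Proof. by rewrite /weight avoids_gt_neq_cons0 des_cons0. Qed.

Lemma open_weight_cons0 s : s != [::] ->
  open_weight (0%N :: s) = open_weight s.
Proof. by rewrite /open_weight weight_cons0 ends_in_descent_cons0 => ->. Qed.

Lemma weight_mapS s : weight (map S s) = weight s.
Proof. by rewrite /weight avoids_gt_neq_mapS des_mapS. Qed.

Lemma open_weight_mapS s : open_weight (map S s) = open_weight s.
Proof.
by rewrite /open_weight weight_mapS ends_in_descent_mapS; case: s.
Qed.

Lemma weight_nil : weight [::] = 1.
Proof. by rewrite /weight avoids_gt_neq_nil des_nil. Qed.

(** A nonempty Catalan word is 0 or starts with 00 exactly when its factor [u] is empty, so a single
    product remains. *)
Lemma word_gf_flat : word_gf flat_weight = fps_x * word_gf weight.
Proof.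
rewrite (@word_gf_first_return _ _ [:: (one_nil, weight)]) => [|u v _ cv].
  by rewrite big_seq1 /= word_gf_nil mul1r [X in X + _](_ : _ = 0) ?add0r.
rewrite big_seq1 /one_nil /flat_weight /=.
case: u => [|a u] /=; last by rewrite mul0r.
by rewrite mul1r weight_cons0 (head_catalan cv).
Qed.

Lemma word_gf_flat_open :
  word_gf flat_open_weight = fps_x * word_gf open_weight.
Proof.
rewrite (@word_gf_first_return _ _ [:: (one_nil, open_weight)]) => [|u v _ cv].
  by rewrite big_seq1 /= word_gf_nil mul1r [X in X + _](_ : _ = 0) ?add0r.
rewrite big_seq1 /one_nil /flat_open_weight /=.
case: u => [|a u] /=; last by rewrite mul0r.
rewrite mul1r (head_catalan cv) eqxx andbT.
by have [-> //|v0] := eqVneq v [::]; rewrite open_weight_cons0.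
Qed.

Lemma word_gf_weight :
  word_gf weight = 1 + fps_x * (2 * word_gf weight - 1 +
    fps_const y * fps_x * word_gf open_weight * word_gf weight).
Proof.
(* The pairs stand for [u] empty, [v] empty, a correction for counting both empty twice, and both
   nonempty. *)
rewrite {1}(@word_gf_first_return _ weight
  [:: (one_nil, weight); (weight, one_nil); (fun s => -1 * one_nil s, one_nil);
      (fun s => y * open_weight s, flat_weight)]) => [|u v _ cv].
  rewrite !big_cons big_nil /= !word_gfZ word_gf_nil word_gf_flat weight_nil.
  rewrite (_ : fps_const (-1) = -1); last by apply: fpsP => -[|n] //=; rewrite oppr0.
  rewrite (_ : fps_const 1 = 1) //; ring.
rewrite !big_cons big_nil /one_nil /= weight_cons0.
have [->|u0] := eqVneq u [::].
  rewrite /open_weight /= weight_nil.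
  by case: v {cv} => [|b v] /=; rewrite ?weight_nil; ring.
case: v cv => [|b v] /head_catalan /=.
  by move=> _; rewrite cats0 weight_mapS /flat_weight /=; ring.
(* From here on [v] is the tail of the second factor, whose first letter is 0. *)
move=> ->; rewrite {1}/weight /flat_weight /= avoids_gt_neq_mapS_cat0 // des_mapS_cat0 //.
rewrite /open_weight u0 /weight /=.
case: (avoids_gt_neq u); case: (ends_in_descent u); case: (head 0%N v == 0%N);
  case: (avoids_gt_neq (0%N :: v)) => /=; rewrite ?exprS ?exprD; ring.
Qed.

Lemma word_gf_open_weight :
  word_gf open_weight = fps_x * (1 + 2 * word_gf open_weight +
    fps_const y * fps_x * word_gf open_weight ^+ 2).
Proof.
(* Since [open_weight] vanishes on the empty word, the word 0 needs its own pair, the first one; no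
   double count then arises. *)
rewrite {1}(@word_gf_first_return _ open_weight
  [:: (one_nil, one_nil); (one_nil, open_weight); (open_weight, one_nil);
      (fun s => y * open_weight s, flat_open_weight)]) => [|u v _ cv].
  rewrite !big_cons big_nil /= !word_gfZ word_gf_nil word_gf_flat_open.
  by rewrite (_ : fps_const _ = 0) //; ring.
rewrite !big_cons big_nil /one_nil /=.
have [->|u0] := eqVneq u [::].
  rewrite [open_weight [::]]/open_weight /=.
  case: v {cv} => [|b v] /=; last by rewrite open_weight_cons0 //; ring.
  by rewrite /open_weight /= weight_cons0 weight_nil; ring.
case: v cv => [|b v] /head_catalan /=.
  move=> _; rewrite cats0 open_weight_cons0 ?open_weight_mapS; last by case: u u0.
  by rewrite /flat_open_weight /=; ring.
move=> ->; rewrite open_weight_cons0; last by case: u u0.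
rewrite /flat_open_weight /=.
rewrite {1}/open_weight /weight ends_in_descent_mapS_cat0 //.
rewrite avoids_gt_neq_mapS_cat0 // des_mapS_cat0 // negb_or ends_in_descent_cons0.
have -> : map S u ++ 0%N :: v != [::] by case: u {u0}.
have [_|v0] := eqVneq v [::]; first by rewrite /=; ring.
rewrite open_weight_cons0 // /open_weight v0 u0 -(weight_cons0 v) /weight /=.
(* A final descent in [v] makes both sides vanish. *)
case: (ends_in_descent v) => /=; first by rewrite !if_same; ring.
case: (avoids_gt_neq u); case: (ends_in_descent u); case: (head 0%N v == 0%N);
  case: (avoids_gt_neq (0%N :: v)) => /=; rewrite ?exprS ?exprD; ring.
Qed.

End Equations.

(** * Solving the equations *)

Theorem theorem3p32 :
  let x : fps {poly rat} := fps_x in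
  let y : fps {poly rat} := fps_const 'X in
  let C := catalan_gf (fun a b => (a > b)%N) (fun a b => a != b) in
  2 * x ^+ 3 * y * C =
    (1 - 2 * x - fps_sqrt (1 - 4 * x + 4 * x ^+ 2 - 4 * x ^+ 3 * y)) * (1 - x).
Proof.
move=> x y C.
(* Avoidance moves from the range of the sum into the weight, which is 0 on all other words. *)
have CE : C = word_gf (weight 'X).
  apply: fpsP => n /=; rewrite big_filter big_map big_enum_cond /=.
  by rewrite -big_mkcondr.
have := word_gf_weight ('X : {poly rat}).
have := word_gf_open_weight ('X : {poly rat}).
rewrite -CE -/x -/y; set E := word_gf _ => EE CC.
pose U := 1 - 2 * x - x ^+ 2 * y * E.
have EU : E * U = x.
  (* [E * U - x] is the difference of the two sides of [EE]; [CU] is obtained from [CC] in the same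
     way. *)
  transitivity (E - x * (1 + 2 * E + y * x * E ^+ 2) + x).
    by rewrite /U; ring.
  by rewrite -EE subrr add0r.
have CU : C * U = 1 - x.
  transitivity (C - (1 + x * (2 * C - 1 + y * x * E * C)) + (1 - x)).
    by rewrite /U; ring.
  by rewrite -CC subrr add0r.
(* Writing [x] as [E * U] turns [x * C] into [E * (C * U)], which avoids dividing by [U]. *)
have xC : x * C = (1 - x) * E by rewrite -CU -[x in LHS]EU; ring.
set D := 1 - 4 * x + _ - _; pose S := 1 - 2 * x - 2 * x ^+ 2 * y * E.
have SD : S ^+ 2 = D.
  (* Completing the square: the terms of [S ^+ 2] containing [E] combine into a multiple of
     [E * U]. *)
  transitivity (1 - 4 * x + 4 * x ^+ 2 - 4 * x ^+ 2 * y * (E * U)).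
    by rewrite /S /U; ring.
  by rewrite EU /D; ring.
(* Both [S] and [D] have the form [1 - x * f]; the constant term 1 singles out [S] among the square
   roots of [D]. *)
have const1 f : (1 - x * f) 0%N = 1.
  by rewrite -[LHS]/(1 - (x * f) 0%N) fps_xM0 subr0.
have S0 : S 0%N = 1.
  by rewrite -(const1 (2 + 2 * x * y * E)); congr (fps_coef _ _); rewrite /S; ring.
have D0 : D 0%N = 1.
  rewrite -(const1 (4 - 4 * x + 4 * x ^+ 2 * y)); congr (fps_coef _ _).
  by rewrite /D; ring.
have unit2 : (2 : {poly rat}) \is a GRing.unit.
  by rewrite -(rmorph_nat polyC) rmorph_unit // unitfE.
have [r0 rD] := fps_sqrtP unit2 D0.
have -> : fps_sqrt D = S by apply: (fps_sqrt_uniq unit2) => //; rewrite rD SD.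
transitivity (2 * x ^+ 2 * y * (x * C)); first by ring.
by rewrite xC /S; ring.
Qed.
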